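(* Let $\mathbb K$ be a commutative field and $\mathcal X$ a finite set of free non-commuting variables. For every invertible series $A\in\mathbb K\langle\!\langle\mathcal X\rangle\!\rangle^*$ one has $$\dim(\overline{A^{-1}}+\mathbb K)=\dim(\overline A+\mathbb K)$$ and $$\dim(\overline A)-1\le\dim(\overline{A^{-1}})\le\dim(\overline A)+1,$$ where dimensions take values in $\mathbb N\cup\{\infty\}$.
   Context: $\mathcal X^*$ is the free monoid on $\mathcal X$. $\mathbb K\langle\!\langle\mathcal X\rangle\!\rangle$ is the algebra of non-commutative formal power series $A=\sum_{\mathbf X\in\mathcal X^*}(A,\mathbf X)\mathbf X$ with the convolution product. $\mathbb K\langle\!\langle\mathcal X\rangle\!\rangle^*$ is its group of units (the series with non-zero constant coefficient). For $\mathbf T\in\mathcal X^*$ the shift map is $\rho(\mathbf T)A=\sum_{\mathbf X\in\mathcal X^*}(A,\mathbf X\mathbf T)\mathbf X$. The recursive closure $\overline A$ is the linear span of $\{\rho(\mathbf T)A:\mathbf T\in\mathcal X^*\}$. $\mathbb K$ is identified with the space of constant series. *)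

(* Defs.v *)
From HB Require Import structures.
From mathcomp Require Import all_boot all_order all_algebra.
From mathcomp Require Import zify.
From mathcomp Require Import mathcomp_extra boolp classical_sets functions.
From mathcomp Require Export constructive_ereal.

Set Implicit Arguments.
Unset Strict Implicit.
Unset Printing Implicit Defensive.

Import Order.TTheory GRing.Theory Num.Theory.
Local Open Scope ring_scope.
Local Open Scope classical_set_scope.

(* Subspaces of a vector space that may be infinite-dimensional, as predicates. *)
Section Dimension.
Variables (K : fieldType) (M : lmodType K).
Implicit Types (S U V : set M).

Definition lin_span S : set M :=
  [set v | exists n (c : 'I_n -> K) (f : 'I_n -> M),
     (forall i, S (f i)) /\ v = \sum_(i < n) c i *: f i].

Definition subspace_add U V : set M :=
  [set w | exists u v, [/\ U u, V v & w = u + v]].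

Definition lin_indep n (b : 'I_n -> M) : Prop :=
  forall c : 'I_n -> K, \sum_(i < n) c i *: b i = 0 -> forall i, c i = 0.

Definition has_basis V n : Prop :=
  exists b : 'I_n -> M, lin_indep b /\ lin_span (range b) = V.

(* The value of xget does not depend on a choice, by has_basis_uniq below. *)
Definition dimension V : \bar int :=
  if `[< exists n, has_basis V n >]
  then ((xget 0%N [set n | has_basis V n])%:Z)%:E else +oo%E.

Lemma lin_span_range n (b : 'I_n -> M) v :
  lin_span (range b) v -> exists c : 'I_n -> K, v = \sum_i c i *: b i.
Proof.
case=> m [c] [f] [Sf ->].
have /choice [g gE] : forall i, exists j, b j = f i.
  by move=> i; case: (Sf i) => j _ <-; exists j.
exists (fun j => \sum_(i | g i == j) c i).
rewrite (partition_big g xpredT) //=; apply: eq_bigr => j _.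
by rewrite scaler_suml; apply: eq_bigr => i /eqP <-; rewrite gE.
Qed.

Lemma has_basis_leq V n m : has_basis V n -> has_basis V m -> (n <= m)%N.
Proof.
have mem_span k (b : 'I_k -> M) j : lin_span (range b) (b j).
  exists 1%N, (fun=> 1), (fun=> b j); split=> [_|]; first by exists j.
  by rewrite big_ord1 scale1r.
move=> [b [bi bV]] [b' [_ b'V]].
have /choice [P PE] :
    forall i, exists c : 'I_m -> K, b i = \sum_j c j *: b' j.
  by move=> i; apply: lin_span_range; rewrite b'V -bV; apply: mem_span.
have /choice [Q QE] :
    forall j, exists c : 'I_n -> K, b' j = \sum_i c i *: b i.
  by move=> j; apply: lin_span_range; rewrite bV -b'V; apply: mem_span.
pose MP : 'M[K]_(n, m) := \matrix_(i, j) P i j.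
pose MQ : 'M[K]_(m, n) := \matrix_(j, i) Q j i.
apply: (@mulmx1_min K n m MP MQ).
apply/matrixP => i k; rewrite !mxE; apply/eqP; rewrite -subr_eq0; apply/eqP.
under eq_bigr do rewrite !mxE.
move: k; apply: (bi (fun k => \sum_j P i j * Q j k - (i == k)%:R)).
under eq_bigr do rewrite scalerBl.
rewrite sumrB; apply/eqP; rewrite subr_eq0; apply/eqP.
transitivity (b i); last first.
  rewrite (bigD1 i) //= eqxx scale1r big1 ?addr0 // => k /negPf ik.
  by rewrite eq_sym ik scale0r.
rewrite [RHS]PE; under [RHS]eq_bigr do rewrite QE scaler_sumr.
rewrite exchange_big /=; apply: eq_bigr => k _.
by rewrite scaler_suml; apply: eq_bigr => j _; rewrite scalerA.
Qed.

Lemma has_basis_uniq V n m : has_basis V n -> has_basis V m -> n = m.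
Proof.
move=> Vn Vm; apply/eqP.
by rewrite eqn_leq (has_basis_leq Vn Vm) (has_basis_leq Vm Vn).
Qed.

Lemma dimensionE V n : has_basis V n -> dimension V = (n%:Z)%:E.
Proof.
move=> Vn; rewrite /dimension asboolT; last by exists n.
by case: xgetP => [_ -> /= /(has_basis_uniq Vn) <- //|/(_ n)].
Qed.

End Dimension.

(* Words over X are sequences and the coefficient (A, w) is A w.  A record
   rather than an alias of seq X -> K keeps the convolution product apart from
   the pointwise one that MathComp-Analysis puts on function types. *)
Record series (K : fieldType) (X : finType) : Type :=
  Series { coef :> seq X -> K }.

HB.instance Definition _ (K : fieldType) (X : finType) :=
  gen_eqMixin (series K X).
HB.instance Definition _ (K : fieldType) (X : finType) :=
  gen_choiceMixin (series K X).

Section Series.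
Variables (K : fieldType) (X : finType).
Implicit Types (A B C : series K X) (w : seq X).

Lemma seriesP A B : (forall w, A w = B w) -> A = B.
Proof. by case: A B => [f] [g] /= fg; congr Series; apply/funext. Qed.

Definition series_zero : series K X := Series (fun=> 0).
Definition series_opp A : series K X := Series (fun w => - A w).
Definition series_add A B : series K X := Series (fun w => A w + B w).
Definition series_scale (c : K) A : series K X := Series (fun w => c * A w).

Lemma series_addA : associative series_add.
Proof. by move=> A B C; apply: seriesP => w /=; rewrite addrA. Qed.

Lemma series_addC : commutative series_add.
Proof. by move=> A B; apply: seriesP => w /=; rewrite addrC. Qed.

Lemma series_add0 : left_id series_zero series_add.
Proof. by move=> A; apply: seriesP => w /=; rewrite add0r. Qed.

Lemma series_addN : left_inverse series_zero series_opp series_add.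
Proof. by move=> A; apply: seriesP => w /=; rewrite addNr. Qed.

HB.instance Definition _ := GRing.isZmodule.Build (series K X)
  series_addA series_addC series_add0 series_addN.

Lemma series_scaleA (c d : K) A :
  series_scale c (series_scale d A) = series_scale (c * d) A.
Proof. by apply: seriesP => w /=; rewrite mulrA. Qed.

Lemma series_scale1 : left_id 1 series_scale.
Proof. by move=> A; apply: seriesP => w /=; rewrite mul1r. Qed.

Lemma series_scaleDr : right_distributive series_scale +%R.
Proof. by move=> c A B; apply: seriesP => w /=; rewrite mulrDr. Qed.

Lemma series_scaleDl A : {morph series_scale^~ A : c d / c + d}.
Proof. by move=> c d; apply: seriesP => w /=; rewrite mulrDl. Qed.

HB.instance Definition _ := GRing.Zmodule_isLmodule.Build K (series K X)
  series_scaleA series_scale1 series_scaleDr series_scaleDl.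

Lemma series_addE A B w : (A + B) w = A w + B w. Proof. by []. Qed.

Lemma series_oppE A w : (- A) w = - A w. Proof. by []. Qed.

Lemma series_scaleE (c : K) A w : (c *: A) w = c * A w. Proof. by []. Qed.

Definition series_one : series K X := Series (fun w => (w == [::])%:R).

Definition series_mul A B : series K X := Series (fun w =>
  \sum_(i < (size w).+1) A (take i w) * B (drop i w)).

Let lder x A : series K X := Series (fun w => A (x :: w)).

Lemma series_mul_nil A B : series_mul A B [::] = A [::] * B [::].
Proof. by rewrite /= big_ord1. Qed.

Let mul_cons A B x w :
  series_mul A B (x :: w) = A [::] * B (x :: w) + series_mul (lder x A) B w.
Proof. by rewrite /= big_ord_recl. Qed.

Lemma series_mulDl : left_distributive series_mul +%R.
Proof.
move=> A B C; apply: seriesP => w; rewrite series_addE -big_split.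
by apply: eq_bigr => i _; rewrite series_addE mulrDl.
Qed.

Lemma series_mulDr : right_distributive series_mul +%R.
Proof.
move=> A B C; apply: seriesP => w; rewrite series_addE -big_split.
by apply: eq_bigr => i _; rewrite series_addE mulrDr.
Qed.

Lemma series_scaleAl (c : K) A B :
  c *: series_mul A B = series_mul (c *: A) B.
Proof.
apply: seriesP => w; rewrite series_scaleE mulr_sumr.
by apply: eq_bigr => i _; rewrite series_scaleE mulrA.
Qed.

Lemma series_scaleAr (c : K) A B :
  c *: series_mul A B = series_mul A (c *: B).
Proof.
apply: seriesP => w; rewrite series_scaleE mulr_sumr.
by apply: eq_bigr => i _; rewrite series_scaleE mulrCA.
Qed.

Lemma series_mulA : associative series_mul.
Proof.
move=> A B C; apply: seriesP => w.
elim: w A B C => [|x w IHw] A B C; first by rewrite !series_mul_nil mulrA.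
rewrite !mul_cons series_mul_nil IHw.
have -> : lder x (series_mul A B) =
          A [::] *: lder x B + series_mul (lder x A) B.
  by apply: seriesP => v; apply: mul_cons.
by rewrite series_mulDl -series_scaleAl series_addE series_scaleE mulrDr !mulrA
  addrA.
Qed.

Lemma series_mul1l : left_id series_one series_mul.
Proof.
move=> A; apply: seriesP => w; rewrite /= big_ord_recl big1 /=.
  by rewrite take0 drop0 eqxx mul1r addr0.
by case: w => [[]//|x w] i _; rewrite mul0r.
Qed.

Lemma series_mul1r : right_id series_one series_mul.
Proof.
move=> A; apply: seriesP => w; rewrite /= big_ord_recr big1 /=.
  by rewrite add0r take_size drop_size eqxx mulr1.
move=> i _; rewrite -size_eq0 size_drop subn_eq0 leqNgt ltn_ord.
by rewrite mulr0.
Qed.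

Lemma series_one_neq0 : series_one != 0.
Proof.
apply/eqP => /(congr1 (fun A : series K X => A [::])) /eqP.
by rewrite /= oner_eq0.
Qed.

HB.instance Definition _ := GRing.Zmodule_isNzRing.Build (series K X)
  series_mulA series_mul1l series_mul1r series_mulDl series_mulDr
  series_one_neq0.

HB.instance Definition _ :=
  GRing.Lmodule_isLalgebra.Build K (series K X) series_scaleAl.

HB.instance Definition _ :=
  GRing.Lalgebra_isAlgebra.Build K (series K X) series_scaleAr.

Lemma series_mulE A B w :
  (A * B) w = \sum_(i < (size w).+1) A (take i w) * B (drop i w).
Proof. by []. Qed.

Lemma series_oneE w : (1 : series K X) w = (w == [::])%:R.
Proof. by []. Qed.

Definition series_unit : pred (series K X) := fun A => A [::] != 0.

(* Geometric series: A = a (1 - N) with a = A [::] and N [::] = 0, so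
   A^-1 = a^-1 (1 + N + N^2 + ...), where N^n vanishes on words shorter
   than n. *)
Definition series_inv A : series K X :=
  if series_unit A then Series (fun w =>
    (A [::])^-1 * \sum_(n < (size w).+1) ((1 - (A [::])^-1 *: A) ^+ n) w)
  else A.

Let expr_small (N : series K X) n w :
  N [::] = 0 -> (size w < n)%N -> (N ^+ n) w = 0.
Proof.
move=> N0; elim: n w => // n IHn w ltwn.
rewrite exprS series_mulE big1 // => i _.
case: (posnP i) => [->|i_gt0]; first by rewrite take0 N0 mul0r.
rewrite IHn ?mulr0 // size_drop; have := ltn_ord i.
by lia.
Qed.

Let geom (N : series K X) k : series K X := \sum_(n < k.+1) N ^+ n.

Let geom_app N k w : geom N k w = \sum_(n < k.+1) (N ^+ n) w.
Proof. by rewrite /geom; elim/big_rec2: _ => // n x y _ <-. Qed.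

Section Inverse.
Variable A : series K X.
Hypothesis unitA : series_unit A.
Let a := A [::].
Let N : series K X := 1 - a^-1 *: A.

Let N0 : N [::] = 0.
Proof.
rewrite /N series_addE series_oneE eqxx.
by rewrite series_oppE series_scaleE mulVf // subrr.
Qed.

Let AE : A = a *: (1 - N).
Proof. by rewrite /N subKr scalerA mulfV // scale1r. Qed.

Let invE k w : (size w <= k)%N ->
  series_inv A w = (a^-1 *: geom N k) w.
Proof.
move=> lewk; rewrite /series_inv unitA series_scaleE geom_app; congr (_ * _).
rewrite -(subnKC lewk) -addSn big_split_ord /= [X in _ = _ + X]big1 ?addr0 //.
by move=> i _; apply: expr_small => //=; rewrite addSn ltnS leq_addr.
Qed.

Let geom1 w : (1 - N ^+ (size w).+1) w = (1 : series K X) w.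
Proof.
by rewrite series_addE series_oppE expr_small // subr0.
Qed.

Let geomE k : (1 - N) * geom N k = 1 - N ^+ k.+1.
Proof. by rewrite -[RHS]opprB subrX1 -[RHS]mulNr [in RHS]opprB. Qed.

Let geom_comm k : geom N k * (1 - N) = (1 - N) * geom N k.
Proof.
rewrite mulrBr mulrBl mulr1 mul1r; congr (_ - _).
by apply: commr_sym; apply: commr_sum => i _; apply: commrX.
Qed.

Lemma series_mulrV : A * series_inv A = 1.
Proof.
apply: seriesP => w; rewrite -geom1 -geomE.
transitivity ((A * (a^-1 *: geom N (size w))) w).
  rewrite !series_mulE; apply: eq_bigr => i _; congr (_ * _).
  by apply: invE; rewrite size_drop leq_subr.
by rewrite [in LHS]AE -scalerAr -scalerAl scalerA mulVf // scale1r.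
Qed.

Lemma series_mulVr : series_inv A * A = 1.
Proof.
apply: seriesP => w; rewrite -geom1 -geomE -geom_comm.
transitivity (((a^-1 *: geom N (size w)) * A) w).
  rewrite !series_mulE; apply: eq_bigr => i _; congr (_ * _).
  by apply: invE; rewrite size_take_min geq_minr.
by rewrite [in LHS]AE -scalerAr -scalerAl scalerA mulfV // scale1r.
Qed.

End Inverse.

Lemma series_unitP A B : B * A = 1 /\ A * B = 1 -> series_unit A.
Proof.
case=> _ /(congr1 (fun C : series K X => C [::])).
rewrite series_mulE big_ord1 /= => AB; apply/eqP => A0.
by move: AB; rewrite A0 mul0r => /eqP; rewrite eq_sym oner_eq0.
Qed.

Lemma series_inv_out : {in [predC series_unit], series_inv =1 id}.
Proof. by move=> A; rewrite inE => nuA; rewrite /series_inv ifN. Qed.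

HB.instance Definition _ := GRing.NzRing_hasMulInverse.Build (series K X)
  series_mulVr series_mulrV series_unitP series_inv_out.

Lemma series_unitE A : (A \is a GRing.unit) = (A [::] != 0).
Proof. by []. Qed.

Definition shift (t : seq X) A : series K X := Series (fun w => A (w ++ t)).

Definition rec_closure A : set (series K X) := lin_span (range (shift^~ A)).

End Series.

Definition constants (K : fieldType) (X : finType) : set (series K X) :=
  range (fun c : K => c%:A).
Arguments constants : clear implicits.

(* Main.v *)
(** Since [shift [:: x]] is a twisted derivation, [A * A^-1 = 1] gives
    [shift [:: x] A^-1 = - A^-1[::] *: (A^-1 * shift [:: x] A)].  Hence, writing
    [V_A] for the sum of the recursive closure of [A] and the constants, the
    space [A^-1 * V_A] contains [A^-1] and [1] and is stable under shifts, so it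
    contains [V_(A^-1)]; exchanging [A] and [A^-1] gives
    [V_(A^-1) = A^-1 * V_A], and multiplication by [A^-1] is an isomorphism. *)

Require Import Defs.
From HB Require Import structures.
From mathcomp Require Import all_boot all_order all_algebra.
From mathcomp Require Import boolp classical_sets.
Import Order.TTheory GRing.Theory Num.Theory.
Local Open Scope ring_scope.

Set Implicit Arguments.
Unset Strict Implicit.
Unset Printing Implicit Defensive.

Local Open Scope classical_set_scope.

(** * Subspaces as predicates, and bounds on their dimension *)

Section Subspaces.
Variables (K : fieldType) (M : lmodType K).
Implicit Types (S U V : set M) (v : M).

Definition is_subspace U : Prop :=
  U 0 /\ forall (c : K) u v, U u -> U v -> U (c *: u + v).

Lemma subspaceD U u v : is_subspace U -> U u -> U v -> U (u + v).
Proof. by case=> _ US Uu Uv; rewrite -[u]scale1r; apply: US. Qed.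

Lemma subspaceZ U (c : K) u : is_subspace U -> U u -> U (c *: u).
Proof. by case=> U0 US Uu; rewrite -[_ *: _]addr0; apply: US. Qed.

Lemma sub_lin_span S : S `<=` lin_span S.
Proof.
move=> v Sv; exists 1%N, (fun=> 1), (fun=> v).
by rewrite big_ord1 scale1r.
Qed.

Lemma lin_span_is_subspace S : is_subspace (lin_span S).
Proof.
split; first by exists 0%N, (fun=> 0), (fun=> 0); rewrite big_ord0; split=> [[]|].
move=> c _ _ [n [a [f [Sf ->]]]] [m [b [g [Sg ->]]]].
exists (n + m)%N.
exists (fun i => match split i with inl j => c * a j | inr j => b j end).
exists (fun i => match split i with inl j => f j | inr j => g j end).
split=> [i|]; first by case: (split i).
rewrite big_split_ord scaler_sumr /=.
congr (_ + _); apply: eq_bigr => i _.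
  by rewrite (unsplitK (inl i)) scalerA.
by rewrite (unsplitK (inr i)).
Qed.

Lemma lin_span_min S U : is_subspace U -> S `<=` U -> lin_span S `<=` U.
Proof.
move=> sU SU _ [n [c [f [Sf ->]]]].
elim/big_ind: _ => [||i _]; first by case: sU.
  by move=> u v; apply: subspaceD.
by apply: subspaceZ => //; apply: SU.
Qed.

Lemma subspace_add_is_subspace U V :
  is_subspace U -> is_subspace V -> is_subspace (subspace_add U V).
Proof.
move=> [U0 US] [V0 VS]; split; first by exists 0, 0; rewrite addr0.
move=> c _ _ [u [v [Uu Vv ->]]] [u' [v' [Uu' Vv' ->]]].
exists (c *: u + u'), (c *: v + v'); split; [exact: US|exact: VS|].
by rewrite scalerDr addrACA.
Qed.

Lemma subspace_addl U V : is_subspace V -> U `<=` subspace_add U V.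
Proof. by case=> V0 _ u Uu; exists u, 0; rewrite addr0. Qed.

Lemma subspace_addr U V : is_subspace U -> V `<=` subspace_add U V.
Proof. by case=> U0 _ v Vv; exists 0, v; rewrite add0r. Qed.

Lemma line_is_subspace v : is_subspace (range (fun c : K => c *: v)).
Proof.
split; first by exists 0; rewrite ?scale0r.
move=> c _ _ [a _ <-] [b _ <-]; exists (c * a + b) => //.
by rewrite scalerDl scalerA.
Qed.

(** The coordinates of [b] with respect to [b'] form an m by n matrix. A row vector killing it is a
    linear relation among the [b i], so the matrix has rank m, which is at most n. *)
Lemma lin_indep_leq m n (b : 'I_m -> M) (b' : 'I_n -> M) :
  lin_indep b -> (forall i, lin_span (range b') (b i)) -> (m <= n)%N.
Proof.
move=> bi bb'.
have /choice [P PE] : forall i, exists c : 'I_n -> K, b i = \sum_j c j *: b' j.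
  by move=> i; apply: lin_span_range.
have : row_free (\matrix_(i, j) P i j).
  apply: inj_row_free => u /rowP uP; apply/rowP => i; rewrite mxE.
  apply: (bi (u 0)); under eq_bigr do rewrite PE scaler_sumr.
  rewrite exchange_big big1 //= => j _.
  under eq_bigr do rewrite scalerA.
  rewrite -scaler_suml; move: (uP j); rewrite !mxE.
  by under eq_bigr do rewrite mxE; move=> ->; rewrite scale0r.
by rewrite /row_free => /eqP <-; apply: rank_leq_col.
Qed.

Lemma lin_indep_extend m (b : 'I_m -> M) v :
  lin_indep b -> ~ lin_span (range b) v ->
  lin_indep (fun i : 'I_m.+1 => oapp b v (unlift ord0 i)).
Proof.
move=> bi bv c; rewrite big_ord_recl unlift_none /=.
under eq_bigr do rewrite liftK /=.
move=> cbv.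
have c0 : c ord0 = 0.
  have [//|c0] := eqVneq (c ord0) 0; case: bv.
  exists m, (fun i => - (c ord0)^-1 * c (lift ord0 i)), b.
  split=> [i|]; first by exists i.
  under eq_bigr do rewrite -scalerA.
  rewrite -scaler_sumr; move/eqP: cbv; rewrite addrC addr_eq0 => /eqP ->.
  by rewrite scalerN scaleNr opprK scalerA mulVf // scale1r.
move: cbv; rewrite c0 scale0r add0r => /(bi (fun i => c (lift ord0 i))) cl i.
by case: (unliftP ord0 i) => [j|] ->.
Qed.

(** Independent families in [U] have length at most n, so one of maximal length exists. It spans
    [U], since a vector outside its span would extend it. *)
Lemma subspace_has_basis U n (b : 'I_n -> M) :
  is_subspace U -> U `<=` lin_span (range b) ->
  exists2 m, (m <= n)%N & has_basis U m.
Proof.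
move=> sU Ub.
pose P m := `[< exists b' : 'I_m -> M, lin_indep b' /\ forall i, U (b' i) >].
have exP : exists m, P m.
  by exists 0%N; apply/asboolP; exists (fun=> 0); split=> [c _|] [].
have leP m : P m -> (m <= n)%N.
  by case/asboolP => b' [b'i Ub']; apply: (lin_indep_leq b'i) => i; apply: Ub.
case: (ex_maxnP exP leP) => m Pm maxm; exists m; first exact: leP.
case/asboolP: Pm => b' [b'i Ub']; exists b'; split=> //.
apply/seteqP; split; first by apply: lin_span_min => // _ [i _ <-].
move=> u Uu; apply: contrapT => b'u.
suff /maxm : P m.+1 by rewrite ltnn.
apply/asboolP; exists (fun i => oapp b' u (unlift ord0 i)).
by split=> [|i]; [apply: lin_indep_extend | case: unlift => [j|] /=].
Qed.

Lemma dimension_le U V :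
  is_subspace U -> U `<=` V -> (dimension U <= dimension V)%E.
Proof.
move=> sU UV; have [[n Vn]|nV] := pselect (exists n, has_basis V n); last first.
  by rewrite [X in (_ <= X)%E]/dimension asboolF // leey.
rewrite (dimensionE Vn); case: Vn => b [_ bV].
case: (@subspace_has_basis U n b sU) => [|m mn Um]; first by rewrite bV.
by rewrite (dimensionE Um) lee_fin lez_nat.
Qed.

Lemma dimension_add_line U v : is_subspace U ->
  (dimension (subspace_add U (range (fun c : K => c *: v)))
     <= dimension U + 1)%E.
Proof.
move=> sU; have [[n Un]|nU] := pselect (exists n, has_basis U n); last first.
  by rewrite [in X in (_ <= X)%E]/dimension asboolF //= leey.
rewrite (dimensionE Un); case: Un => b [_ bU].
(* Prefixing [v] to a basis of [U] gives n + 1 spanning vectors. They may be dependent, as [v] may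
   lie in [U], hence only an inequality. *)
pose b' (i : 'I_n.+1) := oapp b v (unlift ord0 i).
have sb' : is_subspace (lin_span (range b')) by apply: lin_span_is_subspace.
have [|m mn Wm] := @subspace_has_basis _ _ b'
  (subspace_add_is_subspace sU (line_is_subspace v)).
  move=> _ [u [_ [Uu [c _ <-] ->]]]; apply: subspaceD => //.
    move: Uu; rewrite -bU; apply: lin_span_min => // _ [i _ <-].
    apply: sub_lin_span; exists (lift ord0 i) => //.
    by rewrite /b' liftK.
  apply: subspaceZ => //; apply: sub_lin_span; exists ord0 => //.
  by rewrite /b' unlift_none.
by rewrite (dimensionE Wm) -EFinD lee_fin -PoszD lez_nat addn1.
Qed.

End Subspaces.

Lemma has_basis_image (K : fieldType) (M N : lmodType K) (f : M -> N)
    (V : set M) n :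
  linear f -> injective f -> has_basis V n -> has_basis (f @` V) n.
Proof.
move=> lf injf [b [bi bV]].
pose g : {linear M -> N} :=
  HB.pack f (GRing.isLinear.Build K M N *:%R f lf).
have fsum k (c : 'I_k -> K) h :
    f (\sum_i c i *: h i) = \sum_i c i *: f (h i).
  rewrite -[f]/(g : M -> N) linear_sum.
  by apply: eq_bigr => i _; rewrite linearZ.
exists (f \o b); split=> [c /= |].
  by rewrite -fsum -[RHS](linear0 g) => /injf; apply: bi.
rewrite -bV; apply/seteqP; split=> [v /lin_span_range[c ->]|].
  exists (\sum_i c i *: b i); last exact: fsum.
  by exists n, c, b; split=> // i; exists i.
move=> _ [_ /lin_span_range[c ->] <-].
by exists n, c, (f \o b); split=> [i|]; [exists i | exact: fsum].
Qed.

(** * Shifts, recursive closures and their behaviour under inversion *)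

Section RecursiveClosure.
Variables (K : fieldType) (X : finType).
Implicit Types (A B C : series K X) (x : X) (t : seq X) (V : set (series K X)).

Definition shift_stable V : Prop := forall x C, V C -> V (shift [:: x] C).

Lemma shift_nil A : shift [::] A = A.
Proof. by apply: seriesP => w; rewrite /= cats0. Qed.

Lemma shift_cons x t A : shift (x :: t) A = shift [:: x] (shift t A).
Proof. by apply: seriesP => w; rewrite /= -catA. Qed.

Lemma shift_linear t : linear (@shift K X t).
Proof. by move=> c A B; apply: seriesP. Qed.

Lemma shift_letter1 x : shift [:: x] 1 = 0 :> series K X.
Proof. by apply: seriesP => -[]. Qed.

(** Cut the word [w ++ [:: x]] in two. The cut after [x] leaves the empty word to [B] and gives the
    second term; every other cut leaves [x] at the end of the right factor. *)
Lemma shift_letterM x A B :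
  shift [:: x] (A * B) = A * shift [:: x] B + B [::] *: shift [:: x] A.
Proof.
apply: seriesP => w; transitivity ((A * B) (w ++ [:: x])); first by [].
rewrite series_addE series_scaleE !series_mulE size_cat addn1 big_ord_recr /=.
rewrite -[in take _.+1 _](addn1 (size w)) -[in drop _.+1 _](addn1 (size w)).
rewrite -(size_cat w [:: x]) take_size drop_size [B _ * _]mulrC; congr (_ + _).
apply: eq_bigr => i _; rewrite take_cat drop_cat.
(* The only index not below [size w] is [size w] itself, the cut just before [x]. *)
have [//|wi] := ltnP i (size w).
have -> : i = size w :> nat by apply/eqP; rewrite eqn_leq wi -ltnS ltn_ord.
by rewrite subnn take_size drop_size take0 cats0 drop0.
Qed.

Lemma shift_letterV x A : A \is a GRing.unit ->
  shift [:: x] A^-1 = A^-1 * (- A^-1 [::] *: shift [:: x] A).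
Proof.
move=> uA; have := shift_letterM x A A^-1.
rewrite divrr // shift_letter1 => /esym/eqP; rewrite addr_eq0 => /eqP E.
by rewrite scaleNr -E mulKr.
Qed.

Lemma rec_closure_is_subspace A : is_subspace (rec_closure A).
Proof. exact: lin_span_is_subspace. Qed.

(** Stability under single letters is enough, because a shift by a word is a composite of letter
    shifts. *)
Lemma rec_closure_min A V :
  is_subspace V -> shift_stable V -> V A -> rec_closure A `<=` V.
Proof.
move=> sV shV VA; apply: lin_span_min => // _ [t _ <-].
by elim: t => [|x t IHt]; [rewrite shift_nil|rewrite shift_cons; apply: shV].
Qed.

(** [c%:A] is [c *: 1], so the constants are the line spanned by 1. *)
Lemma constants_is_subspace : is_subspace (constants K X).
Proof. exact: line_is_subspace. Qed.

(** This is the space [V_A] of the overview. *)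
Definition ext_closure A := subspace_add (rec_closure A) (constants K X).

Lemma ext_closure_is_subspace A : is_subspace (ext_closure A).
Proof.
exact: subspace_add_is_subspace (rec_closure_is_subspace A)
  constants_is_subspace.
Qed.

Lemma rec_closure_sub_ext A : rec_closure A `<=` ext_closure A.
Proof. exact: subspace_addl constants_is_subspace. Qed.

Lemma ext_closure_mem A : ext_closure A A.
Proof.
apply: rec_closure_sub_ext; apply: sub_lin_span.
by exists [::] => //; apply: shift_nil.
Qed.

Lemma ext_closure1 A : ext_closure A 1.
Proof.
apply: (subspace_addr (rec_closure_is_subspace A)).
by exists 1; rewrite ?scale1r.
Qed.

Lemma shift_stable_ext_closure A : shift_stable (ext_closure A).
Proof.
have sV := ext_closure_is_subspace A.
move=> x _ [u [_ [Au [c _ <-] ->]]].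
rewrite addrC shift_linear shift_letter1 scaler0 add0r.
(* The constant part has been killed by the shift. The preimage of a subspace under a shift is a
   subspace, so the rest is checked on the generators [shift t A]. *)
suff : rec_closure A `<=` [set C | ext_closure A (shift [:: x] C)] by apply.
apply: lin_span_min => [|_ [t _ <-]] /=.
  split=> /= [|a B C VB VC]; last by rewrite shift_linear; apply: (proj2 sV).
  have -> : shift [:: x] 0 = 0 :> series K X by apply: seriesP.
  exact: (proj1 sV).
apply: rec_closure_sub_ext; apply: sub_lin_span.
by exists (x :: t) => //; apply: shift_cons.
Qed.

Lemma series_mull_linear A : linear ( *%R A).
Proof. by move=> c B C; rewrite mulrDr scalerAr. Qed.

Lemma mul_ext_closure_is_subspace A B :
  is_subspace ( *%R B @` ext_closure A).
Proof.
have [V0 VS] := ext_closure_is_subspace A.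
split; first by exists 0; rewrite ?mulr0.
move=> c _ _ [C VC <-] [D VD <-]; exists (c *: C + D); first exact: VS.
exact: series_mull_linear.
Qed.

Lemma ext_closureV_sub A : A \is a GRing.unit ->
  ext_closure A^-1 `<=` *%R A^-1 @` ext_closure A.
Proof.
move=> uA; have sW := mul_ext_closure_is_subspace A A^-1.
have sV := ext_closure_is_subspace A.
have W1 : ( *%R A^-1 @` ext_closure A) 1.
  by exists A; [exact: ext_closure_mem | rewrite mulVr].
suff AW : rec_closure A^-1 `<=` *%R A^-1 @` ext_closure A.
  move=> _ [u [_ [Au [c _ <-] ->]]].
  by apply: subspaceD => //; [apply: AW | apply: subspaceZ].
(* The constants enter here: [A^-1] is [A^-1 * 1], and 1 need not lie in [rec_closure A]. *)
apply: rec_closure_min => //; last first.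
  by exists 1; [exact: ext_closure1 | rewrite mulr1].
move=> x _ [C VC <-]; rewrite shift_letterM shift_letterV //.
(* Factoring out [A^-1] leaves [shift [:: x] C] plus a multiple of [shift [:: x] A], both in
   [ext_closure A]. *)
rewrite scalerAr -mulrDr; eexists; last by [].
have shV := @shift_stable_ext_closure A x.
apply: subspaceD => //; first exact: shV.
by do 2!apply: subspaceZ => //; apply: shV; apply: ext_closure_mem.
Qed.

Lemma ext_closureV A : A \is a GRing.unit ->
  ext_closure A^-1 = *%R A^-1 @` ext_closure A.
Proof.
move=> uA; apply/seteqP; split; first exact: ext_closureV_sub.
have uV : A^-1 \is a GRing.unit by rewrite unitrV.
move=> _ [C + <-]; rewrite -{1}[A]invrK => /(ext_closureV_sub uV)[D VD <-].
by rewrite invrK mulKr.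
Qed.

Lemma dimension_ext_closureV A : A \is a GRing.unit ->
  dimension (ext_closure A^-1) = dimension (ext_closure A).
Proof.
have half B n : B \is a GRing.unit ->
    has_basis (ext_closure B) n -> has_basis (ext_closure B^-1) n.
  move=> uB; rewrite ext_closureV //; apply: has_basis_image.
    exact: series_mull_linear.
  by apply: mulrI; rewrite unitrV.
move=> uA; rewrite /dimension.
(* [dimension] depends only on which lengths of bases occur, so this settles the finite and infinite
   cases together. *)
suff -> : has_basis (ext_closure A^-1) = has_basis (ext_closure A) by [].
apply/funext => n; apply/propext; split; last exact: half.
by rewrite -{2}[A]invrK; apply: half; rewrite unitrV.
Qed.

(** [rec_closure A^-1] lies in [ext_closure A^-1], which has the dimension of [ext_closure A], and
    the latter adds a single line to [rec_closure A]. *)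
Lemma dimension_rec_closureV_le A : A \is a GRing.unit ->
  (dimension (rec_closure (A^-1)%R) <= dimension (rec_closure A) + 1)%E.
Proof.
move=> uA; apply: (@le_trans _ _ (dimension (ext_closure A^-1))).
  apply: dimension_le; first exact: rec_closure_is_subspace.
  exact: rec_closure_sub_ext.
rewrite dimension_ext_closureV //; apply: dimension_add_line.
exact: rec_closure_is_subspace.
Qed.

End RecursiveClosure.

Local Open Scope ereal_scope.

Theorem corollary5p6 (K : fieldType) (X : finType) (A : series K X)
    (hA : A \is a GRing.unit) :
  dimension (subspace_add (rec_closure (A^-1)%R) (constants K X))
    = dimension (subspace_add (rec_closure A) (constants K X))
  /\ (dimension (rec_closure A) - 1 <= dimension (rec_closure (A^-1)%R)
       /\ dimension (rec_closure (A^-1)%R) <= dimension (rec_closure A) + 1).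
Proof.
split; first exact: dimension_ext_closureV.
split; last exact: dimension_rec_closureV_le.
(* The lower bound is the upper bound for [A^-1]; moving 1 across is valid even at [+oo] because 1
   is finite. *)
rewrite leeBlDr // -{1}[A]invrK.
by apply: dimension_rec_closureV_le; rewrite unitrV.
Qed.
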